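(* Let $0<\alpha<1$, $f:[0,\infty)\times\mathbb{R}^d\to\mathbb{R}^d$, and consider for $h>0$, $t_n=nh$, the scheme (F-BDF) $$\sum_{j=0}^n\omega_{n-j}x_j=h^\alpha f(t_n,x_n),\qquad n=1,2,3,\dots,$$ with real weights $\{\omega_j\}_{j=0}^\infty$ satisfying $\omega_0>0$; $\omega_j\le0$ for all $j\ge1$; and $\sum_{j=0}^n\omega_j\ge0$ for every $n\ge1$. Assume moreover that there is a constant $c_\alpha>0$ such that for every $n\in\mathbb{N}^+$ one has $|\omega_k|\le c_\alpha/k^{1+\alpha}$ for $1\le k\le n-1$ and $|\omega_n|\le c_\alpha/n^\alpha$. (i) Suppose $f$ satisfies the one-sided Lipschitz condition $\langle f(t,u)-f(t,v),u-v\rangle\le\lambda\|u-v\|^2$ for all $u,v\in\mathbb{R}^d$ and all $t$, with a constant $\lambda\le 0$, and that $\rho_1=\sum_{j=1}^\infty\frac{|\omega_j|}{\omega_0-2\lambda h^\alpha}<1$ for any $h>0$. Then the F-BDF is contractive with the following rate: for any two solutions $\{x_n\}$, $\{y_n\}$ of the scheme with initial values $x_0$, $y_0$, $$\|x_n-y_n\|^2\le c_1\,\|x_0-y_0\|^2\,n^{-\alpha}\quad\text{as } n\to\infty,\qquad c_1=(1-\rho_1)^{-1}\frac{c_\alpha}{\omega_0-2\lambda h^\alpha}.$$ (ii) Suppose $f$ satisfies $\langle f(t,u),u\rangle\le a-b\|u\|^2$ for all $u\in\mathbb{R}^d$ and all $t$, with constants $a\ge0$, $b>0$, and that $\rho_2=\sum_{j=1}^\infty\frac{|\omega_j|}{\omega_0+2bh^\alpha}<1$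 for any $h>0$. Then the F-BDF is dissipative: for any initial value $x_0$ and any $\varepsilon>0$, setting $r=\sqrt{c_2a/b}+\varepsilon$ with $c_2=(1-\rho_2)^{-1}$, there is $n_0\in\mathbb{N}^+$ such that $x_n\in B(0,r)$ for all $n\ge n_0$. Moreover, if the condition on $f$ holds with $a=0$, then $$\|x_n\|^2\le c_3\,\|x_0\|^2\,n^{-\alpha}\quad\text{as } n\to\infty,\qquad c_3=(1-\rho_2)^{-1}\frac{c_\alpha}{\omega_0+2bh^\alpha}.$$
   Context: $\langle\cdot,\cdot\rangle$ and $\|\cdot\|$ are the standard inner product and norm on $\mathbb{R}^d$, and $B(0,r)$ is the ball of radius $r$ centred at $0$. A solution of the scheme with initial value $x_0$ is a sequence $\{x_n\}_{n\ge0}\subset\mathbb{R}^d$ starting at $x_0$ and satisfying the scheme for all $n\ge1$. An inequality ''as $n\to\infty$'' means that it holds for all sufficiently large $n$. *)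

(* Defs.v *)
From HB Require Import structures.
From mathcomp Require Export all_boot all_order all_algebra.
From mathcomp Require Export all_classical all_reals all_analysis.

Set Implicit Arguments.
Unset Strict Implicit.
Unset Printing Implicit Defensive.

Export Order.TTheory GRing.Theory Num.Theory.
Export numFieldNormedType.Exports.

Local Open Scope classical_set_scope.
Local Open Scope ring_scope.

(* The canonical norm `|u| and [ball] on 'rV[R]_d are those of the sup norm,
   hence the Euclidean versions below. *)
Definition edot (R : realType) (d : nat) (u v : 'rV[R]_d) : R :=
  \sum_(i < d) u 0 i * v 0 i.

Definition enorm (R : realType) (d : nat) (u : 'rV[R]_d) : R :=
  Num.sqrt (edot u u).

Definition eball (R : realType) (d : nat) (r : R) : set 'rV[R]_d :=
  [set u | enorm u < r].

(* The equation is not imposed at n = 0, where x 0 is prescribed. *)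
Definition fbdf_solution (R : realType) (d : nat) (alpha : R)
    (omega : nat -> R) (f : R -> 'rV[R]_d -> 'rV[R]_d) (h : R)
    (x0 : 'rV[R]_d) (x : nat -> 'rV[R]_d) : Prop :=
  x 0%N = x0 /\
  forall n : nat, (1 <= n)%N ->
    \sum_(0 <= j < n.+1) omega (n - j)%N *: x j =
      (h `^ alpha) *: f (n%:R * h) (x n).

Definition fbdf_weights (R : realType) (omega : nat -> R) : Prop :=
  [/\ 0 < omega 0%N,
      forall j : nat, (1 <= j)%N -> omega j <= 0 &
      forall n : nat, (1 <= n)%N -> 0 <= \sum_(0 <= j < n.+1) omega j].

Definition weight_decay (R : realType) (alpha : R) (omega : nat -> R)
    (c : R) : Prop :=
  forall n : nat, (1 <= n)%N ->
    (forall k : nat, (1 <= k)%N -> (k <= n - 1)%N ->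
       `|omega k| <= c / k%:R `^ (1 + alpha)) /\
    `|omega n| <= c / n%:R `^ alpha.

(* The vector field lives on [0, +oo[ x R^d: its values at t < 0 are junk and
   are never constrained. *)
Definition one_sided_lipschitz (R : realType) (d : nat)
    (f : R -> 'rV[R]_d -> 'rV[R]_d) (lambda : R) : Prop :=
  forall (t : R) (u v : 'rV[R]_d), 0 <= t ->
    edot (f t u - f t v) (u - v) <= lambda * enorm (u - v) ^+ 2.

Definition dissipativity_condition (R : realType) (d : nat)
    (f : R -> 'rV[R]_d -> 'rV[R]_d) (a b : R) : Prop :=
  forall (t : R) (u : 'rV[R]_d), 0 <= t ->
    edot (f t u) u <= a - b * enorm u ^+ 2.

Definition rho1 (R : realType) (alpha : R) (omega : nat -> R)
    (lambda h : R) : R :=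
  \big[+%R/0]_(1 <= j <oo) (`|omega j| / (omega 0%N - 2 * lambda * h `^ alpha)).

Definition rho2 (R : realType) (alpha : R) (omega : nat -> R) (b h : R) : R :=
  \big[+%R/0]_(1 <= j <oo) (`|omega j| / (omega 0%N + 2 * b * h `^ alpha)).

(* Main.v *)
Require Import Defs.
From mathcomp Require Import zify ring lra.

(** Put z n = |u n|^2, where u is the difference of two solutions (contractivity)
or one solution (dissipativity). Pair the scheme with u n. Since the weights of
positive index are nonpositive and of total mass at most omega 0, Young's
inequality 2<u j, u n> <= |u j|^2 + |u n|^2 gives
  omega 0 * z n - sum_(j < n) |omega (n - j)| * z j
    <= 2 <sum_(j <= n) omega (n - j) u j, u n>                 (fbdf_energy),
and the condition on f bounds the right-hand side. What is left is a scalar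
Volterra inequality
  z n <= A / Q + sum_(j < n) p (n - j) * z j,   p k = |omega k| / Q,
with Q = omega 0 - 2 lambda h^alpha or Q = omega 0 + 2 b h^alpha. Its kernel has
mass rho < 1 and, taking n = k + 1 in the decay hypothesis, satisfies
p k <= C * k^-(1 + alpha) for every k >= 1.

For A = 0 this is a defective renewal inequality. First, its solutions are
summable, with sum at most z 0 / (1 - rho) (sum_le_of_defective_renewal). Then
they inherit the decay of the kernel, z n <= M * z 0 * n^-(1 + alpha)
(defective_renewal_decay): in the convolution, the indices j close to n carry a
fraction less than 1 of the bound to be proved, as rho < 1, while for the other
indices the kernel is of size n^-(1 + alpha) and z is summable. This rate is
better than n^-alpha by a factor n, so every positive constant in front of
n^-alpha is eventually large enough, in particular c1 and c3; M depends neither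
on the solution nor on its initial value.

For A > 0, m = A / Q / (1 - rho) is the equilibrium of the recursion, and the
positive part of z - m satisfies the inequality with A = 0. Hence z n is at most
m + o(1) (fbdf_decay_forced). In the dissipative case A = 2 a h^alpha, so that
A / Q <= a / b and m <= c2 * a / b. *)

Set Implicit Arguments.
Unset Strict Implicit.
Unset Printing Implicit Defensive.

Local Open Scope classical_set_scope.
Local Open Scope ring_scope.

(** * Energy inequality *)

Lemma edotDl (R : realType) (d : nat) (u v w : 'rV[R]_d) :
  edot (u + v) w = edot u w + edot v w.
Proof.
by rewrite /edot -big_split; apply: eq_bigr => i _; rewrite mxE mulrDl.
Qed.

Lemma edotZl (R : realType) (d : nat) (c : R) (u w : 'rV[R]_d) :
  edot (c *: u) w = c * edot u w.
Proof.
by rewrite /edot mulr_sumr; apply: eq_bigr => i _; rewrite mxE mulrA.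
Qed.

Lemma edot_suml (R : realType) (d : nat) (w : 'rV[R]_d) (F : nat -> 'rV[R]_d)
    (m n : nat) :
  edot (\sum_(m <= j < n) F j) w = \sum_(m <= j < n) edot (F j) w.
Proof.
apply: (big_morph (fun u => edot u w)) => [u v|]; first exact: edotDl.
by rewrite -(scale0r 0) edotZl mul0r.
Qed.

Lemma enorm_sqr (R : realType) (d : nat) (u : 'rV[R]_d) :
  enorm u ^+ 2 = edot u u.
Proof.
by rewrite sqr_sqrtr //; apply: sumr_ge0 => i _; rewrite -expr2 sqr_ge0.
Qed.

Lemma edot_young (R : realType) (d : nat) (u v : 'rV[R]_d) :
  2 * edot u v <= enorm u ^+ 2 + enorm v ^+ 2.
Proof.
rewrite !enorm_sqr /edot mulr_sumr -big_split /=; apply: ler_sum => i _.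
by have := sqr_ge0 (u 0 i - v 0 i); rewrite expr2; nra.
Qed.

Lemma big_convolution_rev (R : realType) (F : nat -> R) (n : nat) :
  \sum_(0 <= j < n) F (n - j)%N = \sum_(1 <= k < n.+1) F k.
Proof.
rewrite big_nat_rev /= big_add1 /=; apply: eq_big_nat => j /andP[_ jn].
by congr F; lia.
Qed.

(** A discrete form of <u', u> = (|u|^2)' / 2. Young's inequality applies to each
term of positive index because its weight is nonpositive; the |u n|^2 so produced
cost at most half of the diagonal term 2 * omega 0 * |u n|^2, by the sign of
the partial sums of the weights. *)
Lemma fbdf_energy (R : realType) (d : nat) (omega : nat -> R)
    (u : nat -> 'rV[R]_d) (n : nat) :
  fbdf_weights omega -> (1 <= n)%N ->
  omega 0%N * enorm (u n) ^+ 2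
    - \sum_(0 <= j < n) `|omega (n - j)%N| * enorm (u j) ^+ 2
  <= 2 * edot (\sum_(0 <= j < n.+1) omega (n - j)%N *: u j) (u n).
Proof.
move=> [w0 wneg wsum] n1.
have sum_le : - omega 0%N <= \sum_(0 <= j < n) omega (n - j)%N.
  have := wsum n n1; rewrite (big_convolution_rev omega) big_nat_recl //= big_add1 /=.
  lra.
rewrite edot_suml big_nat_recr //= subnn edotZl -enorm_sqr mulrDr.
have termwise : \sum_(0 <= j < n) omega (n - j)%N * enorm (u n) ^+ 2
    - \sum_(0 <= j < n) `|omega (n - j)%N| * enorm (u j) ^+ 2
    <= 2 * \sum_(0 <= j < n) edot (omega (n - j)%N *: u j) (u n).
  rewrite -sumrB mulr_sumr; apply: ler_sum_nat => j /andP[_ jn].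
  have wj : omega (n - j)%N <= 0 by apply: wneg; lia.
  rewrite edotZl ler0_norm //.
  by have := edot_young (u j) (u n); nra.
move: termwise; rewrite -mulr_suml => termwise.
have := sqr_ge0 (enorm (u n)); nra.
Qed.

(** * Defective renewal inequalities *)

(** Instead of exchanging a double sum, weight z j by 1 minus the kernel mass
it can still send to indices at most n: by the recursion this weighted sum does not
increase with n, and it starts at z 0. All the weights are at least
1 - rho. *)
Lemma sum_le_of_defective_renewal (R : realType) (p z : nat -> R) (rho : R) :
  (forall n, \sum_(1 <= k < n) p k <= rho) -> rho < 1 ->
  (forall n, 0 <= z n) ->
  (forall n, (1 <= n)%N -> z n <= \sum_(0 <= j < n) p (n - j)%N * z j) ->
  forall n, \sum_(0 <= j < n) z j <= z 0%N / (1 - rho).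
Proof.
move=> prho rho1 z0 zrec n.
pose P m := \sum_(0 <= j < m) z j * (1 - \sum_(1 <= k < (m - j)) p k).
have Ple m : P m.+1 <= z 0%N.
  elim: m => [|m IH]; first by rewrite /P big_nat1 big_geq // subr0 mulr1.
  apply: le_trans IH; rewrite /P [leLHS]big_nat_recr //=.
  have -> : (m.+2 - m.+1 = 1)%N by lia.
  rewrite [X in _ * (1 - X)]big_geq // subr0 mulr1.
  have -> : \sum_(0 <= j < m.+1) z j * (1 - \sum_(1 <= k < m.+2 - j) p k)
    = \sum_(0 <= j < m.+1) z j * (1 - \sum_(1 <= k < m.+1 - j) p k)
      - \sum_(0 <= j < m.+1) p (m.+1 - j)%N * z j.
    rewrite -sumrB; apply: eq_big_nat => j /andP[_ jm].
    rewrite subSn; last by lia.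
    by rewrite big_nat_recr /=; [ring | lia].
  by have := zrec m.+1 isT; lra.
rewrite ler_pdivlMr ?subr_gt0 // mulr_suml.
case: n => [|n]; first by rewrite big_geq.
apply: le_trans (Ple n); apply: ler_sum => j _.
by apply: ler_wpM2l => //; have := prho (n.+1 - j)%N; lra.
Qed.

(** Strong induction on z n <= K * n^-beta with K = M * z 0. The cut theta is
chosen so that theta^beta = s lies strictly between rho and 1. The indices
j >= theta * n contribute at most rho / s * K * n^-beta by induction; the
others, for which n - j > (1 - theta) * n, contribute at most
D * n^-beta times the sum of z. K is the value that closes the induction. *)
Lemma defective_renewal_decay (R : realType) (p : nat -> R) (rho C beta : R) :
  0 < beta -> 0 <= C -> 0 <= rho -> rho < 1 ->
  (forall k, 0 <= p k) ->
  (forall n, \sum_(1 <= k < n) p k <= rho) ->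
  (forall k, (1 <= k)%N -> p k <= C * k%:R `^ (- beta)) ->
  exists2 M, 0 <= M & forall z : nat -> R,
    (forall n, 0 <= z n) ->
    (forall n, (1 <= n)%N -> z n <= \sum_(0 <= j < n) p (n - j)%N * z j) ->
    forall n, (1 <= n)%N -> z n <= M * z 0%N * n%:R `^ (- beta).
Proof.
move=> beta0 C0 rho0 rho1 p0 prho pdecay.
pose s := (1 + rho) / 2.
have s0 : 0 < s by rewrite /s; lra.
have s1 : s < 1 by rewrite /s; lra.
have rhos : rho / s < 1 by rewrite ltr_pdivrMr // mul1r /s; lra.
pose theta := s `^ beta^-1.
have theta0 : 0 < theta by rewrite powR_gt0.
have thetaE : theta `^ beta = s.
  by rewrite -powRrM mulVf ?gt_eqF // powRr1 // ltW.
have theta1 : theta < 1.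
  have := gt0_ltr_powR (r := beta^-1); rewrite invr_gt0 => /(_ beta0 s 1).
  by rewrite powR1; apply; rewrite ?nnegrE ?ler01 ?ltW.
pose D := C * (1 - theta) `^ (- beta).
have D0 : 0 <= D by rewrite mulr_ge0 // powR_ge0.
pose M := D / (1 - rho) / (1 - rho / s).
exists M; first by rewrite /M !divr_ge0 // subr_ge0 ltW.
move=> z z0 zrec.
have zsum := sum_le_of_defective_renewal prho rho1 z0 zrec.
pose K := M * z 0%N.
have K0 : 0 <= K by rewrite mulr_ge0 // /M !divr_ge0 // subr_ge0 ltW.
(* The equation that M solves; it closes the induction in the last step. *)
have KE : rho * (K / s) + D * (z 0%N / (1 - rho)) = K.
  have : K * (1 - rho / s) = D / (1 - rho) * z 0%N.
    by rewrite /K /M mulrAC divfK // gt_eqF // subr_gt0.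
  have -> : rho * (K / s) = K * (rho / s) by rewrite mulrCA.
  have -> : D * (z 0%N / (1 - rho)) = D / (1 - rho) * z 0%N.
    by rewrite mulrA mulrAC.
  by move=> <-; ring.
elim/ltn_ind => n IH n1; rewrite -/K.
set N := n%:R `^ (- beta).
have npos : 0 < n%:R :> R by rewrite ltr0n.
have N0 : 0 <= N by rewrite powR_ge0.
have DN0 : 0 <= D * N by exact: mulr_ge0.
have KN0 : 0 <= K / s * N by apply: mulr_ge0 => //; rewrite divr_ge0 // ltW.
(* Both regimes are covered by the sum of their bounds, which avoids splitting
   the sum at theta * n. The index 0 falls in the second one, so the induction
   hypothesis is only used at j >= 1. *)
have termwise j : (0 <= j < n)%N ->
    p (n - j)%N * z j <= p (n - j)%N * (K / s * N) + D * N * z j.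
  move=> /andP[_ jn].
  have [jlarge|jsmall] := leP (theta * n%:R) j%:R.
  - rewrite -[leLHS]addr0; apply: lerD; last exact: mulr_ge0.
    apply: ler_wpM2l => //.
    have j1 : (1 <= j)%N by rewrite -(ltr0n R); apply: lt_le_trans jlarge; exact: mulr_gt0.
    apply: le_trans (IH j jn j1) _; rewrite -/K -mulrA; apply: ler_wpM2l => //.
    rewrite /N !powRN -invfM lef_pV2 ?posrE ?(mulr_gt0 s0) ?powR_gt0 ?ltr0n //.
    rewrite -thetaE -powRM ?(ltW theta0) //.
    by apply: ge0_ler_powR => //; rewrite ?nnegrE ?(ltW beta0) ?mulr_ge0 // ltW.
  - rewrite -[leLHS]add0r; apply: lerD; first exact: mulr_ge0.
    apply: ler_wpM2r; first exact: z0.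
    apply: (le_trans (pdecay _ _)); first by rewrite subn_gt0.
    rewrite /D -mulrA; apply: ler_wpM2l => //.
    have th1 : 0 < 1 - theta by rewrite subr_gt0.
    rewrite /N -powRM ?(ltW th1) ?(ltW npos) // !powRN.
    rewrite lef_pV2 ?posrE ?powR_gt0 ?ltr0n ?subn_gt0 ?(mulr_gt0 th1) //.
    apply: ge0_ler_powR; rewrite ?nnegrE ?(ltW beta0) ?mulr_ge0 ?(ltW th1) //.
    by rewrite natrB ?(ltnW jn) //; lra.
apply: le_trans (zrec n n1) _; apply: le_trans (ler_sum_nat termwise) _.
rewrite big_split /= -mulr_suml -mulr_sumr (big_convolution_rev p).
have := zsum n; have := prho n.+1.
set Sp := \sum_(1 <= k < n.+1) p k; set Sz := \sum_(0 <= j < n) z j => Hp Hz.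
rewrite -[leRHS]/(K * N) -[in leRHS]KE mulrDl; apply: lerD.
  by rewrite -[leRHS]mulrA; apply: ler_wpM2r.
by rewrite [leLHS]mulrAC; apply: ler_wpM2r => //; apply: ler_wpM2l.
Qed.

(** The ratio of the two powers is n^-1, which beats any constant. *)
Lemma powR_faster_decay_eventually_le (R : realType) (alpha M c : R) : 0 < c ->
  exists n0, (1 <= n0)%N /\ forall n, (n0 <= n)%N ->
    M * n%:R `^ (- (1 + alpha)) <= c * n%:R `^ (- alpha).
Proof.
move=> c0; exists (Num.trunc (`|M| / c)).+1; split=> // n nn0.
have n0 : (0 < n)%N by lia.
have npos : 0 < n%:R :> R by rewrite ltr0n.
rewrite opprD powRD; last by rewrite (gt_eqF npos) implybT.
rewrite powR_inv1 ?(ltW npos) // mulrA.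
apply: ler_wpM2r; first exact: powR_ge0.
rewrite ler_pdivrMr // mulrC -ler_pdivrMr //.
apply: (@le_trans _ _ (`|M| / c)); first by apply: ler_wpM2r; rewrite ?ler_norm ?invr_ge0 ?ltW.
apply/ltW/(lt_le_trans (truncnS_gt _)); by rewrite ler_nat.
Qed.

(** * Volterra inequalities with the weights of the scheme *)

Lemma weights_partial_sum (R : realType) (omega : nat -> R) :
  fbdf_weights omega ->
  forall n, \sum_(1 <= k < n) `|omega k| <= omega 0%N.
Proof.
move=> [w0 wneg wsum] [|[|n]]; try by rewrite big_geq // ltW.
rewrite (eq_big_nat _ _ (F2 := fun k => - omega k)); last first.
  by move=> k /andP[k1 _]; rewrite ler0_norm // wneg.
rewrite sumrN big_add1 /=.
by have := wsum n.+1 isT; rewrite [X in 0 <= X]big_nat_recl //=; lra.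
Qed.

(** The series defining rho1 and rho2 are limits of sequences of partial sums,
hence bound these only once convergence is known; it follows from
weights_partial_sum. *)
Lemma normalised_weights_partial_sum (R : realType) (omega : nat -> R) (Q : R) :
  fbdf_weights omega -> 0 < Q ->
  forall n, \sum_(1 <= k < n) (`|omega k| / Q)
    <= \big[+%R/0]_(1 <= k <oo) (`|omega k| / Q).
Proof.
move=> w Q0 n.
have p0 k : 0 <= `|omega k| / Q by rewrite divr_ge0 // ltW.
have nd : {homo (fun m => \sum_(1 <= k < m) (`|omega k| / Q)) : a b / (a <= b)%N >-> a <= b}.
  apply: homo_leq => // [x y z|m]; first exact: le_trans.
  case: m => [|m]; first by rewrite !big_geq.
  by rewrite [leRHS]big_nat_recr //= lerDl.
apply: (nondecreasing_cvgn_le nd); apply: nondecreasing_is_cvgn => //.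
exists (omega 0%N / Q) => _ [m _ <-].
by rewrite -mulr_suml ler_pM2r ?invr_gt0 // weights_partial_sum.
Qed.

(** The hypothesis at n = k + 1 puts k in the range with the better
exponent 1 + alpha. *)
Lemma weight_decay_all (R : realType) (alpha : R) (omega : nat -> R) (c Q : R) :
  weight_decay alpha omega c -> 0 < Q ->
  forall k, (1 <= k)%N -> `|omega k| / Q <= c / Q * k%:R `^ (- (1 + alpha)).
Proof.
move=> wd Q0 k k1; have [+ _] := wd k.+1 isT => /(_ k k1).
rewrite powRN mulrAC ler_pM2r ?invr_gt0 //; apply; lia.
Qed.

Lemma fbdf_decay (R : realType) (alpha : R) (omega : nat -> R) (c Q : R) :
  0 < alpha -> fbdf_weights omega -> 0 < c -> weight_decay alpha omega c ->
  0 < Q -> \big[+%R/0]_(1 <= k <oo) (`|omega k| / Q) < 1 ->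
  exists2 M, 0 <= M & forall z : nat -> R,
    (forall n, 0 <= z n) ->
    (forall n, (1 <= n)%N ->
       Q * z n <= \sum_(0 <= j < n) `|omega (n - j)%N| * z j) ->
    forall n, (1 <= n)%N -> z n <= M * z 0%N * n%:R `^ (- (1 + alpha)).
Proof.
move=> a0 w c0 wd Q0 rho1.
have prho := normalised_weights_partial_sum w Q0.
have rho0 : 0 <= \big[+%R/0]_(1 <= k <oo) (`|omega k| / Q).
  by have := prho 1; rewrite big_geq.
have beta0 : 0 < 1 + alpha by lra.
have p0 k : 0 <= `|omega k| / Q by rewrite divr_ge0 // ltW.
have cQ : 0 <= c / Q by rewrite divr_ge0 // ltW.
have [M M0 HM] := defective_renewal_decay beta0 cQ rho0 rho1 p0 prho
  (weight_decay_all wd Q0).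
exists M => // z z0 zrec; apply: HM => // n n1.
rewrite -(ler_pM2l Q0); apply: le_trans (zrec n n1) _.
rewrite mulr_sumr; apply: ler_sum => j _.
by rewrite mulrA mulrCA divff ?gt_eqF // mulr1.
Qed.

(** The constant m solves Q * m = A + Q * rho * m. Since the partial masses of the
kernel are at most rho and m >= 0, subtracting m removes the forcing, and
the positive part keeps the sequence nonnegative, as fbdf_decay requires. *)
Lemma fbdf_decay_forced (R : realType) (alpha : R) (omega : nat -> R)
    (c Q A : R) :
  0 < alpha -> fbdf_weights omega -> 0 < c -> weight_decay alpha omega c ->
  0 < Q -> 0 <= A ->
  let rho := \big[+%R/0]_(1 <= k <oo) (`|omega k| / Q) in
  rho < 1 ->
  exists2 M, 0 <= M & forall z : nat -> R,
    (forall n, 0 <= z n) ->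
    (forall n, (1 <= n)%N ->
       Q * z n <= A + \sum_(0 <= j < n) `|omega (n - j)%N| * z j) ->
    forall n, (1 <= n)%N ->
      z n <= (1 - rho)^-1 * (A / Q) + M * z 0%N * n%:R `^ (- (1 + alpha)).
Proof.
move=> a0 w c0 wd Q0 A0 rho rho1.
have [M M0 HM] := fbdf_decay a0 w c0 wd Q0 rho1.
exists M => // z z0 zrec n n1.
pose m := (1 - rho)^-1 * (A / Q).
have r0 : 0 < 1 - rho by rewrite subr_gt0.
have m0 : 0 <= m.
  by apply: mulr_ge0; [rewrite invr_ge0 ltW | rewrite divr_ge0 // ltW].
have AE : A = Q * m - Q * rho * m.
  rewrite /m -mulrBl -{1}[Q]mulr1 -mulrBr mulrA mulfK ?gt_eqF //.
  by rewrite mulrC divfK ?gt_eqF.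
pose y k := Num.max 0 (z k - m).
have y0 k : 0 <= y k by rewrite le_max lexx.
have zy k : z k <= y k + m by rewrite -lerBlDr le_max lexx orbT.
have yz : y 0%N <= z 0%N by rewrite ge_max z0 lerBlDr lerDl.
have yrec k : (1 <= k)%N ->
    Q * y k <= \sum_(0 <= j < k) `|omega (k - j)%N| * y j.
  move=> k1; have sum0 : 0 <= \sum_(0 <= j < k) `|omega (k - j)%N| * y j.
    by apply: sumr_ge0 => j _; rewrite mulr_ge0.
  rewrite [y k]/y maxr_pMr ?(ltW Q0) // mulr0 ge_max sum0 /=.
  have := zrec k k1.
  have : \sum_(0 <= j < k) `|omega (k - j)%N| * z j
      <= \sum_(0 <= j < k) `|omega (k - j)%N| * y j
       + \sum_(0 <= j < k) `|omega (k - j)%N| * m.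
    by rewrite -big_split /=; apply: ler_sum => j _; rewrite -mulrDr ler_wpM2l.
  rewrite -[X in _ + X]mulr_suml (big_convolution_rev (fun i => `|omega i|)).
  have := normalised_weights_partial_sum w Q0 k.+1.
  rewrite -/rho -mulr_suml ler_pdivrMr // => H.
  have := ler_wpM2r m0 H; rewrite mulrBr; lra.
apply: le_trans (zy n) _; rewrite addrC lerD2l.
apply: le_trans (HM y y0 yrec n n1) _.
by apply: ler_wpM2r; [exact: powR_ge0 | exact: ler_wpM2l].
Qed.

(** * Contractivity and dissipativity *)

Theorem theorem3p4 (R : realType) (d : nat) (alpha : R)
    (f : R -> 'rV[R]_d -> 'rV[R]_d) (omega : nat -> R) (calpha h : R) :
  0 < alpha -> alpha < 1 ->
  fbdf_weights omega ->
  0 < calpha -> weight_decay alpha omega calpha ->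
  0 < h ->
  (forall lambda : R,
     lambda <= 0 ->
     one_sided_lipschitz f lambda ->
     (forall h' : R, 0 < h' -> rho1 alpha omega lambda h' < 1) ->
     let c1 := (1 - rho1 alpha omega lambda h)^-1 *
               (calpha / (omega 0%N - 2 * lambda * h `^ alpha)) in
     forall (x0 y0 : 'rV[R]_d) (x y : nat -> 'rV[R]_d),
       fbdf_solution alpha omega f h x0 x ->
       fbdf_solution alpha omega f h y0 y ->
       \forall n \near \oo,
         enorm (x n - y n) ^+ 2 <= c1 * enorm (x0 - y0) ^+ 2 * n%:R `^ (- alpha))
  /\
  (forall a b : R,
     0 <= a -> 0 < b ->
     dissipativity_condition f a b ->
     (forall h' : R, 0 < h' -> rho2 alpha omega b h' < 1) ->
     let c2 := (1 - rho2 alpha omega b h)^-1 in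
     let c3 := (1 - rho2 alpha omega b h)^-1 *
               (calpha / (omega 0%N + 2 * b * h `^ alpha)) in
     (forall (x0 : 'rV[R]_d) (eps : R), 0 < eps ->
        let r := Num.sqrt (c2 * a / b) + eps in
        exists n0 : nat, (1 <= n0)%N /\
          forall x : nat -> 'rV[R]_d,
            fbdf_solution alpha omega f h x0 x ->
            forall n : nat, (n0 <= n)%N -> eball r (x n))
     /\
     (dissipativity_condition f 0 b ->
        forall (x0 : 'rV[R]_d) (x : nat -> 'rV[R]_d),
          fbdf_solution alpha omega f h x0 x ->
          \forall n \near \oo,
            enorm (x n) ^+ 2 <= c3 * enorm x0 ^+ 2 * n%:R `^ (- alpha))).
Proof.
move=> a0 a1 w c0 wd h0; have [w0 _ _] := w.
have ha : 0 < h `^ alpha by rewrite powR_gt0.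
have tpos n : 0 <= n%:R * h by rewrite mulr_ge0 // ltW.
split.
- move=> lambda l0 fL /(_ h h0); rewrite /rho1.
  set Q := _ - _ => rho1; set c1 := (_^-1 * (calpha / Q)).
  move=> x0 y0 x y [x0E xE] [y0E yE].
  have Q0 : 0 < Q by rewrite /Q; have := mulr_le0_ge0 l0 (ltW ha); lra.
  have c10 : 0 < c1 by rewrite mulr_gt0 ?divr_gt0 // invr_gt0 subr_gt0.
  have [M M0 HM] := fbdf_decay a0 w c0 wd Q0 rho1.
  have [N [N1 HN]] := powR_faster_decay_eventually_le alpha M c10.
  near=> n.
  have nN : (N <= n)%N by near: n; exact: nbhs_infty_ge.
  pose z n := enorm (x n - y n) ^+ 2.
  have zrec k : (1 <= k)%N ->
      Q * z k <= \sum_(0 <= j < k) `|omega (k - j)%N| * z j.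
    move=> k1; have := fbdf_energy (fun j => x j - y j) w k1.
    have -> : \sum_(0 <= j < k.+1) omega (k - j)%N *: (x j - y j)
        = h `^ alpha *: (f (k%:R * h) (x k) - f (k%:R * h) (y k)).
      rewrite scalerBr -xE // -yE // -sumrB.
      by apply: eq_bigr => j _; rewrite scalerBr.
    rewrite edotZl -/(z k) -/(z _) => E.
    have := ler_wpM2l (ltW ha) (fL _ (x k) (y k) (tpos k)).
    rewrite -/(z k) /Q mulrBl; lra.
  have := HM z (fun k => sqr_ge0 _) zrec n (leq_trans N1 nN).
  rewrite /z x0E y0E => /le_trans; apply.
  by rewrite mulrAC [leRHS]mulrAC; apply: ler_wpM2r; [exact: sqr_ge0 | exact: HN].
- move=> a b a_ge0 b0 fD /(_ h h0); rewrite /rho2.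
  set Q := _ + _ => rho1; set c2 := (_ - _)^-1; set c3 := c2 * (calpha / Q).
  have bh : 0 < b * h `^ alpha by rewrite mulr_gt0.
  have Q0 : 0 < Q by rewrite /Q; lra.
  have c20 : 0 < c2 by rewrite invr_gt0 subr_gt0.
  have zrec a' x0 x : dissipativity_condition f a' b ->
      fbdf_solution alpha omega f h x0 x -> forall k, (1 <= k)%N ->
      Q * enorm (x k) ^+ 2 <= 2 * h `^ alpha * a'
        + \sum_(0 <= j < k) `|omega (k - j)%N| * enorm (x j) ^+ 2.
    move=> fa [_ xE] k k1; have := fbdf_energy x w k1.
    rewrite xE // edotZl; have := ler_wpM2l (ltW ha) (fa _ (x k) (tpos k)).
    rewrite /Q mulrDl; lra.
  split.
  + move=> x0 eps eps0; set r := Num.sqrt _ + eps.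
    have A0 : 0 <= 2 * h `^ alpha * a by rewrite !mulr_ge0 // ltW.
    have [M M0 HM] := fbdf_decay_forced a0 w c0 wd Q0 A0 rho1.
    (* Half of eps^2 suffices for z n to be strictly below r^2. *)
    have e20 : 0 < eps ^+ 2 / 2 by rewrite divr_gt0 ?exprn_gt0.
    have [N [N1 HN]] :=
      powR_faster_decay_eventually_le alpha (M * enorm x0 ^+ 2) e20.
    exists N; split=> // x xs n nN; have n1 := leq_trans N1 nN.
    have := HM (fun n => enorm (x n) ^+ 2) (fun k => sqr_ge0 _)
      (zrec a x0 x fD xs) n n1.
    have [-> _] := xs; rewrite -/c2 => Hn.
    have AQ : 2 * h `^ alpha * a / Q <= a / b.
      rewrite ler_pdivrMr // [a / b * Q]mulrAC ler_pdivlMr // /Q.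
      by have := mulr_ge0 a_ge0 (ltW w0); lra.
    have g0 : 0 <= c2 * a / b.
      by apply: divr_ge0; [apply: mulr_ge0 => //|]; exact: ltW.
    have r0 : 0 < r by rewrite ltr_wpDl // sqrtr_ge0.
    have n_small : n%:R `^ (- alpha) <= 1 :> R.
      rewrite powRN invf_le1 ?powR_gt0 ?ltr0n //.
      have := @ge0_ler_powR R alpha (ltW a0) 1 n%:R.
      by rewrite powR1; apply; rewrite ?nnegrE ?ler0n ?ler1n.
    rewrite /eball /= -(ltr_pXn2r (n := 2)) ?nnegrE ?sqrtr_ge0 ?(ltW r0) //.
    apply: le_lt_trans Hn _.
    have c2A := ler_wpM2l (ltW c20) AQ.
    have := HN n nN; have := ler_wpM2l (ltW e20) n_small.
    have sq := sqr_sqrtr g0; have s0 := sqrtr_ge0 (c2 * a / b).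
    rewrite /r sqrrD sq; have := mulr_ge0 s0 (ltW eps0); lra.
  + move=> f0 x0 x xs.
    have c30 : 0 < c3 by rewrite mulr_gt0 // divr_gt0.
    have [M M0 HM] := fbdf_decay a0 w c0 wd Q0 rho1.
    have [N [N1 HN]] := powR_faster_decay_eventually_le alpha M c30.
    near=> n.
    have nN : (N <= n)%N by near: n; exact: nbhs_infty_ge.
    have rec0 k : (1 <= k)%N -> Q * enorm (x k) ^+ 2
        <= \sum_(0 <= j < k) `|omega (k - j)%N| * enorm (x j) ^+ 2.
      by move=> /(zrec 0 x0 x f0 xs); rewrite mulr0 add0r.
    have := HM (fun n => enorm (x n) ^+ 2) (fun k => sqr_ge0 _) rec0 n
      (leq_trans N1 nN).
    have [-> _] := xs => /le_trans; apply.
    by rewrite mulrAC [leRHS]mulrAC; apply: ler_wpM2r;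
      [exact: sqr_ge0 | exact: HN].
Unshelve. all: by end_near.
Qed.
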